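(* Let $\mathcal{H}$ be a separable infinite-dimensional complex Hilbert space. Let $A\in\mathcal{B}(\mathcal{H})$ be singular with closed range, let $b\in\mathcal{H}$, and suppose the set $S=\{x\in\mathcal{H}: Ax=b\}$ is not empty. Let $T\in\mathcal{B}(\mathcal{H})$ be an invertible positive operator (with closed range), and let $R$ be its unique positive square root. Then the problem of minimizing $\langle x,Tx\rangle$ over $x\in S$ has the unique solution $$\hat{x}=R^{-1}(AR^{-1})^\dagger b.$$
   Context: $\mathcal{B}(\mathcal{H})$ denotes the bounded linear operators on $\mathcal{H}$. A self-adjoint operator $T\in\mathcal{B}(\mathcal{H})$ is positive if $\langle Tx,x\rangle\ge 0$ for all $x\in\mathcal{H}$. Invertible means having a bounded inverse; singular means not invertible. For $B\in\mathcal{B}(\mathcal{H})$ with closed range, $B^\dagger$ denotes its generalized (Moore-Penrose) inverse, the unique bounded operator satisfying $BB^\dagger=(BB^\dagger)^*$, $B^\dagger B=(B^\dagger B)^*$, $BB^\dagger B=B$, $B^\dagger BB^\dagger=B^\dagger$. (Under the hypotheses the operator $AR^{-1}$ has closed range, so its Moore-Penrose inverse exists as a bounded operator.) *)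

(* Defs.v *)
From HB Require Import structures.
From mathcomp Require Import all_boot all_order all_algebra.
From mathcomp Require Import complex.
From mathcomp Require Import all_classical all_reals all_analysis.

Set Implicit Arguments.
Unset Strict Implicit.
Unset Printing Implicit Defensive.

Import Order.TTheory GRing.Theory Num.Theory.
Import numFieldNormedType.Exports.

Local Open Scope classical_set_scope.
Local Open Scope ring_scope.
Local Open Scope complex_scope.

(* A complex Hilbert space is a Banach space [H] over [K[i]], with [K] a model
   of the real numbers, whose norm comes from an inner product
   [ip : {dot H for Num.conj}].  Such an [ip] is positive definite, Hermitian,
   linear on the left and conjugate-linear on the right.
   In the order of [K[i]], [u <= v] means that [v - u] is a nonnegative real;
   on real values, such as [ip x (T x)] with [T] self-adjoint, it is the usual
   order. *)

Section operators.
Context {K : realType} {H : completeNormedModType K[i]}.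
Implicit Types (ip : {dot H for Num.conj}) (A B X T : H -> H).

Definition norm_from_inner ip := forall x, ip x x = `|x| ^+ 2.

Definition separable_space := exists2 D : set H, countable D & dense D.

Definition finite_dimensional :=
  exists (n : nat) (e : 'I_n -> H),
    forall x, exists c : 'I_n -> K[i], x = \sum_(i < n) c i *: e i.

Definition bounded_operator A :=
  linear A /\ bounded_near A (nbhs (0 : H)).

Definition bounded_inverse A B :=
  [/\ bounded_operator B, cancel A B & cancel B A].

Definition invertible_op A := exists B, bounded_inverse A B.

Definition singular_op A := ~ invertible_op A.

(* Equal to the zero operator when [A] is not invertible. *)
Definition inv_op A : H -> H := xget (fun=> 0) (bounded_inverse A).

Definition self_adjoint ip A := forall x y, ip (A x) y = ip x (A y).

Definition positive_op ip T :=
  self_adjoint ip T /\ forall x, 0 <= ip (T x) x.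

Definition positive_sqrt ip T B :=
  [/\ bounded_operator B, positive_op ip B & B \o B = T].

Definition moore_penrose ip B X :=
  bounded_operator X /\
  [/\ self_adjoint ip (B \o X), self_adjoint ip (X \o B),
      B \o X \o B = B & X \o B \o X = X].

(* Equal to the zero operator when [B] has no Moore-Penrose inverse. *)
Definition pinv_op ip B : H -> H := xget (fun=> 0) (moore_penrose ip B).

Definition minimizers (q : H -> K[i]) (S : set H) : set H :=
  [set x | S x /\ forall y, S y -> q x <= q y].

End operators.

Arguments separable_space {K} H.
Arguments finite_dimensional {K} H.

(* Main.v *)
Require Import Defs.
From HB Require Import structures.
From mathcomp Require Import all_boot all_order all_algebra.
From mathcomp Require Import complex.
From mathcomp Require Import all_classical all_reals all_analysis.
From mathcomp Require Import ring lra.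

(** Put [S = R^-1], [C = A \o S] and [u = R x]. Since [R] is self-adjoint with
    square [T], the objective [ip x (T x)] is the square of the norm of [u], and
    [A x = b] becomes [C u = b]. The problem is thus to find the solution of
    least norm of [C u = b]. If [X] is the Moore-Penrose inverse of [C] and
    [C u = b], then [X b = X (C u)] is the image of [u] by the orthogonal
    projection [X \o C], so that
    [|u|^2 = |X b|^2 + |u - X b|^2] ([moore_penrose_pythagoras]); as [X b] is
    itself a solution, it is the only one of least norm, and [x = S (X b)].

    The operator [R] is invertible because its square is ([sqrt_invertible]).
    The substance of the proof is the existence of a bounded [X]
    ([moore_penrose_exists]). The range of [C] is that of [A], hence closed. Let
    [P] be the orthogonal projection onto it ([projection_exists]); then [X y]
    is the solution of [C x = P y] orthogonal to the kernel of [C]. The four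
    Penrose equations are immediate, and the graph of [X] is closed since [C]
    and [P] are continuous and the orthogonal complement of the kernel is
    closed. So [X] is bounded by the closed graph theorem ([closed_graph]),
    which rests on a Baire category argument ([dense_in_ball]).

    Limits are handled through explicit estimates on the real-valued norm
    [rnorm]: [closed_approxP] describes closed sets, and [geometric_limit]
    provides all the limits that completeness is needed for. *)

Set Implicit Arguments.
Unset Strict Implicit.
Unset Printing Implicit Defensive.

Import Order.TTheory GRing.Theory Num.Theory.
Import numFieldNormedType.Exports.

Local Open Scope classical_set_scope.
Local Open Scope ring_scope.
Local Open Scope complex_scope.

(** * The norm as a real number *)

Section real_norm.
Context {K : realType} {V : normedModType K[i]}.
Implicit Types (x y z : V) (D : set V).

(** The norm of a space over [K[i]] is [K[i]]-valued; [rnorm] is the same norm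
    with values in the ordered field [K], where estimates can be compared. *)
Definition rnorm (x : V) : K := complex.Re `|x|.

Lemma rnormE x : `|x| = (rnorm x)%:C.
Proof. by rewrite /rnorm RRe_real// ger0_real. Qed.

Lemma rnorm_ge0 x : 0 <= rnorm x.
Proof. by rewrite -lecR -rnormE normr_ge0. Qed.

Lemma rnorm0 : rnorm 0 = 0.
Proof. by rewrite /rnorm normr0. Qed.

Lemma rnormN x : rnorm (- x) = rnorm x.
Proof. by rewrite /rnorm normrN. Qed.

Lemma rnormB x y : rnorm (x - y) = rnorm (y - x).
Proof. by rewrite /rnorm distrC. Qed.

Lemma rnorm_triangle x y : rnorm (x + y) <= rnorm x + rnorm y.
Proof. by rewrite -lecR rmorphD/= -!rnormE ler_normD. Qed.

Lemma rnorm_dist z x y : rnorm (x - y) <= rnorm (x - z) + rnorm (z - y).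
Proof. by rewrite (le_trans _ (rnorm_triangle _ _))// addrA subrK. Qed.

Lemma rnormZ (a : K) x : 0 <= a -> rnorm (a%:C *: x) = a * rnorm x.
Proof.
move=> a0; suff : (rnorm (a%:C *: x))%:C = (a * rnorm x)%:C by case.
by rewrite rmorphM/= -!rnormE normrZ ger0_norm// lecR.
Qed.

Lemma rnorm_eq0 x : rnorm x = 0 -> x = 0.
Proof. by move=> x0; apply/normr0_eq0; rewrite rnormE x0. Qed.

Lemma closed_approxP D : closed D <->
  forall x, (forall e : K, 0 < e -> exists2 y, D y & rnorm (x - y) < e) -> D x.
Proof.
split=> cD x Dx; apply: cD.
  move=> B /nbhs_normP[e /= e0 eB].
  have eE : e = (complex.Re e)%:C by rewrite RRe_real// gtr0_real.
  have [|y Dy xy] := Dx (complex.Re e); first by rewrite -ltcR -eE.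
  by exists y; split=> //; apply: eB; rewrite /= rnormE eE ltcR.
move=> e e0; have [|y [Dy xy]] := Dx [set y | `|x - y| < e%:C].
  by apply/nbhs_normP; exists e%:C; rewrite //= ltcR.
by exists y => //; move: xy; rewrite /= rnormE ltcR.
Qed.

End real_norm.

Section approximation.
Context {K : realType}.

Lemma geometric_lt (c e : K) : 0 < e -> exists n, c * 2^-1 ^+ n < e.
Proof.
move=> e0; exists (Num.truncn (c / e)).
rewrite exprVn ltr_pdivrMr ?exprn_gt0// mulrC -ltr_pdivrMr//.
rewrite (lt_le_trans (truncnS_gt _))// -natrX ler_nat.
exact: ltn_expl.
Qed.

(** A sequence with geometrically decreasing steps converges, with an explicit
    rate; the convergence itself is contained in the rate. *)
Lemma geometric_limit {V : completeNormedModType K[i]} (u : nat -> V) (c : K) :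
  (forall n, rnorm (u n.+1 - u n) <= c * 2^-1 ^+ n) ->
  exists l, forall n, rnorm (l - u n) <= 2 * c * 2^-1 ^+ n.
Proof.
move=> uc.
have c0 : 0 <= c.
  by have := uc 0%N; rewrite expr0 mulr1; apply: le_trans; exact: rnorm_ge0.
have udist n k : rnorm (u (n + k)%N - u n) <= 2 * c * 2^-1 ^+ n.
  suff : rnorm (u (n + k)%N - u n) <= 2 * c * 2^-1 ^+ n * (1 - 2^-1 ^+ k).
    by move=> /le_trans; apply; rewrite ler_piMr ?mulr_ge0// ?gerBl exprn_ge0.
  elim: k => [|k ih]; first by rewrite addn0 !subrr rnorm0 mulr0.
  rewrite addnS (le_trans (rnorm_dist (u (n + k)%N) _ _))//.
  rewrite (le_trans (lerD (uc _) ih))// exprD exprS.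
  by rewrite le_eqVlt; apply/orP; left; apply/eqP; field.
have : cvg (u @ \oo).
  apply: cauchy_cvg; apply: cauchy_exP => e e0.
  have eE : e = (complex.Re e)%:C by rewrite RRe_real// gtr0_real.
  have [|n ne] := @geometric_lt (2 * c) (complex.Re e).
    by rewrite -ltcR -eE.
  exists (u n), n => // m /= nm.
  rewrite -ball_normE /= rnormE eE ltcR rnormB -(subnKC nm).
  exact: le_lt_trans ne.
move=> /cvg_ex[l ul]; exists l => n.
apply/ler_addgt0Pr => e e0.
have : \forall m \near \oo, `|l - u m| < e%:C.
  by apply: cvgr_dist_lt => //; rewrite ltcR.
move=> [N _ Nl]; have := Nl (n + N)%N (leq_addl _ _).
rewrite /= rnormE ltcR => lN.
rewrite [leRHS]addrC (le_trans (rnorm_dist (u (n + N)%N) _ _))// lerD//.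
exact: ltW.
Qed.

End approximation.

(** * Bounded operators *)

Section bounded.
Context {K : realType}.

Lemma linear_opD {V W : lmodType K[i]} (f : V -> W) : linear f ->
  {morph f : x y / x + y}.
Proof. by move=> lf x y; rewrite -[x in LHS]scale1r lf scale1r. Qed.

Lemma linear_opB {V W : lmodType K[i]} (f : V -> W) : linear f ->
  {morph f : x y / x - y}.
Proof.
by move=> lf x y; rewrite addrC -scaleN1r lf scaleN1r addrC.
Qed.

Lemma linear_op0 {V W : lmodType K[i]} (f : V -> W) : linear f -> f 0 = 0.
Proof. by move=> lf; rewrite -(subrr 0) linear_opB// subrr. Qed.

Lemma linear_opZ {V W : lmodType K[i]} (f : V -> W) a : linear f ->
  {morph f : x / a *: x}.
Proof.
by move=> lf x; rewrite -[in LHS](addr0 (a *: x)) lf linear_op0// addr0.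
Qed.

Lemma linear_comp {U V W : lmodType K[i]} (f : V -> W) (g : U -> V) :
  linear f -> linear g -> linear (f \o g).
Proof. by move=> lf lg a x y /=; rewrite lg lf. Qed.

Context {H : completeNormedModType K[i]}.
Implicit Types (A B : H -> H).

Lemma bounded_operatorP A : bounded_operator A <->
  linear A /\ exists2 M : K, 0 <= M & forall x, rnorm (A x) <= M * rnorm x.
Proof.
split=> -[lA bA]; split=> //.
  pose f : {linear H -> H} := HB.pack A (GRing.isLinear.Build _ _ _ _ A lA).
  have /linear_boundedP/pinfty_ex_gt0[r r0 rA] :
    bounded_near f (nbhs (0 : H)) by [].
  have rE : r = (complex.Re r)%:C by rewrite RRe_real// gtr0_real.
  exists (complex.Re r); first by rewrite -lecR -rE ltW.
  by move=> x; have := rA x; rewrite rE !rnormE -rmorphM lecR.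
case: bA => M M0 AM.
apply/ex_bound; exists M%:C; apply/nbhs_norm0P.
exists 1 => /= [|x]; first exact: ltr01.
rewrite /= !rnormE -(rmorph1 (real_complex K)) ltcR lecR => x1.
by rewrite (le_trans (AM x))// ler_piMr// ltW.
Qed.

Lemma bounded_operator_linear A : bounded_operator A -> linear A.
Proof. by case. Qed.

Lemma bounded_operator_comp A B :
  bounded_operator A -> bounded_operator B -> bounded_operator (A \o B).
Proof.
move=> /bounded_operatorP[lA [M M0 AM]] /bounded_operatorP[lB [N N0 BN]].
apply/bounded_operatorP; split; first exact: linear_comp.
exists (M * N) => [|x /=]; first exact: mulr_ge0.
by rewrite (le_trans (AM _))// -mulrA ler_wpM2l.
Qed.

End bounded.

(** * The closed graph theorem *)

Section closed_graph.
Context {K : realType}.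

(** Baire's theorem in the form needed below: if countably many sets cover a
    complete space, then one of them is dense in some ball. *)
Lemma dense_in_ball {V : completeNormedModType K[i]} (E : nat -> set V) :
  (forall x, exists n, E n x) ->
  exists n x (r : K), 0 < r /\ forall y, rnorm (y - x) < r ->
    forall e : K, 0 < e -> exists2 z, E n z & rnorm (z - y) < e.
Proof.
move=> coverE; apply: contrapT => nowhere.
(* Otherwise every ball contains a ball, of at most half its radius, that
   avoids the next set of the family; the factor 4 leaves room for the centres
   to move on without leaving that ball. *)
have shrink (p : nat * (V * {posnum K})) : exists q : V * {posnum K},
    [/\ rnorm (q.1 - p.2.1) <= p.2.2%:num / 4, q.2%:num <= p.2.2%:num / 2 &
        forall z, rnorm (z - q.1) < q.2%:num -> ~ E p.1 z].
  case: p => n [x r] /=; apply: contrapT => noball.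
  apply: nowhere; exists n, x, (r%:num / 4); split=> // y yx e e0.
  apply: contrapT => noz; apply: noball.
  have m0 : 0 < Num.min e (r%:num / 2) by rewrite lt_min e0 /=.
  exists (y, PosNum m0); split=> /=; first exact: ltW.
    by rewrite ge_min lexx orbT.
  move=> z; rewrite lt_min => /andP[ze _] Enz; apply: noz.
  by exists z.
have [f fP] := choice shrink.
pose fix s n : V * {posnum K} :=
  if n is m.+1 then f (m, s m) else (0, PosNum ltr01).
have s_step n : rnorm ((s n.+1).1 - (s n).1) <= (s n).2%:num / 4.
  by have [] := fP (n, s n).
have s_half n : (s n.+1).2%:num <= (s n).2%:num / 2.
  by have [] := fP (n, s n).
have s_avoid n z : rnorm (z - (s n.+1).1) < (s n.+1).2%:num -> ~ E n z.
  by have [_ _] := fP (n, s n); apply.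
have s_radius n k : (s (n + k)%N).2%:num <= (s n).2%:num * 2^-1 ^+ k.
  elim: k => [|k ih]; first by rewrite addn0 mulr1.
  rewrite addnS exprSr mulrA (le_trans (s_half _))//.
  by rewrite ler_wpM2r.
have s_tail n k :
    rnorm ((s (n + k.+1)%N).1 - (s (n + k)%N).1)
      <= (s n).2%:num / 4 * 2^-1 ^+ k.
  rewrite addnS (le_trans (s_step _))// mulrAC ler_wpM2r ?invr_ge0//.
have [l lP] := geometric_limit (s_tail 0%N).
have [n Enl] := coverE l.
apply: (s_avoid n l) => //.
have [l' l'P] := geometric_limit (s_tail n.+1).
have -> : l = l'.
  apply/eqP; rewrite -subr_eq0; apply/eqP/rnorm_eq0/eqP.
  rewrite eq_le rnorm_ge0 andbT; apply/ler_addgt0Pr => e e0; rewrite add0r.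
  have [k ke] := geometric_lt
    (2 * ((s 0%N).2%:num / 4) + 2 * ((s n.+1).2%:num / 4)) e0.
  have := lP (n.+1 + k)%N; rewrite add0n => lk.
  rewrite (le_trans (rnorm_dist (s (n.+1 + k)%N).1 _ _))//.
  rewrite (le_trans _ (ltW ke))// mulrDl lerD//; last by rewrite rnormB.
  rewrite (le_trans lk)// ler_wpM2l// exprD ler_piMl ?exprn_ge0//.
  by rewrite exprn_ile1// invf_le1// ler1n.
have := l'P 0%N; rewrite addn0 expr0 mulr1 => /le_lt_trans; apply.
by have : 0 < (s n.+1).2%:num by []; lra.
Qed.

(** The graph of [F] is closed: every pair that is approximated by points of
    the graph lies on it. *)
Definition graph_closed {V W : normedModType K[i]} (F : V -> W) :=
  forall x y, (forall e : K, 0 < e ->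
    exists2 z, rnorm (x - z) < e & rnorm (y - F z) < e) -> F x = y.

Theorem closed_graph {V W : completeNormedModType K[i]} (F : V -> W) :
  linear F -> graph_closed F ->
  exists2 M : K, 0 <= M & forall x, rnorm (F x) <= M * rnorm x.
Proof.
move=> lF gF.
have [|n [x0 [r [r0 denseE]]]] :=
    dense_in_ball (E := fun n => [set x | rnorm (F x) <= n%:R]).
  move=> x; exists (Num.truncn (rnorm (F x))).+1.
  by rewrite /= ltW// truncnS_gt.
(* Vectors with images of norm at most [n] are dense in the ball at [x0], so
   their differences are dense in the ball of the same radius at [0]. *)
have small y e : rnorm y < r -> 0 < e ->
    exists2 z, rnorm (F z) <= n%:R *+ 2 & rnorm (y - z) < e.
  move=> yr e0; have e2 : 0 < e / 2 by rewrite divr_gt0.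
  have [|z Fz zy] := denseE (x0 + y) _ _ e2; first by rewrite addrC addKr.
  have [|z' Fz' zx] := denseE x0 _ _ e2; first by rewrite subrr rnorm0.
  exists (z - z').
    rewrite linear_opB// (le_trans (rnorm_triangle _ _))// rnormN mulr2n.
    exact: lerD.
  have -> : y - (z - z') = (x0 + y - z) + (z' - x0).
    by rewrite [RHS]addrC !addrA subrK opprB addrA (addrC y).
  rewrite (le_lt_trans (rnorm_triangle _ _))// [ltRHS](splitr e) ltrD//.
  by rewrite rnormB.
pose M := n%:R *+ 2 * (2 / r).
have M0 : 0 <= M by rewrite !mulr_ge0 ?mulrn_wge0// invr_ge0 ltW.
have near y e : 0 < e ->
    exists2 z, rnorm (F z) <= M * rnorm y & rnorm (y - z) < e.
  move=> e0; have [y0|y0] := eqVneq (rnorm y) 0.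
    exists 0; first by rewrite linear_op0// rnorm0 mulr_ge0// rnorm_ge0.
    by rewrite subr0 y0.
  have {}y0 : 0 < rnorm y by rewrite lt_neqAle eq_sym y0 rnorm_ge0.
  pose t := r / 2 / rnorm y.
  have t0 : 0 < t by rewrite !divr_gt0.
  have [||z Fz zy] := small (t%:C *: y) (t * e).
  - by rewrite rnormZ ?(ltW t0)// divfK ?gt_eqF//; lra.
  - exact: mulr_gt0.
  have tV0 : 0 <= t^-1 by rewrite invr_ge0 ltW.
  exists (t^-1%:C *: z).
    rewrite linear_opZ// rnormZ// (le_trans (ler_wpM2l tV0 Fz))//.
    rewrite le_eqVlt; apply/orP; left; apply/eqP; rewrite /t /M.
    by field; rewrite !gt_eqF.
  have -> : y - t^-1%:C *: z = t^-1%:C *: (t%:C *: y - z).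
    by rewrite scalerBr scalerA -rmorphM/= mulVf ?gt_eqF// scale1r.
  by rewrite rnormZ// mulrC ltr_pdivrMr// mulrC.
exists (2 * M) => [|y]; first by rewrite mulr_ge0.
have [y0|y0] := eqVneq (rnorm y) 0.
  by rewrite (rnorm_eq0 y0) linear_op0// !rnorm0 mulr0.
have {}y0 : 0 < rnorm y by rewrite lt_neqAle eq_sym y0 rnorm_ge0.
(* The sums [s k] of successive corrections approach [y] geometrically; the
   image of a correction is bounded by [M] times the error that it corrects, so
   the images of the sums converge as well. *)
have correct (p : nat * V) : exists z,
    rnorm (F z) <= M * rnorm p.2 /\ rnorm (p.2 - z) < rnorm y * 2^-1 ^+ p.1.+1.
  have [|z Fz zp] := near p.2 (rnorm y * 2^-1 ^+ p.1.+1); last by exists z.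
  by rewrite mulr_gt0// exprn_gt0.
have [f fP] := choice correct.
pose fix s n := if n is m.+1 then s m + f (m, y - s m) else 0.
have s_near k : rnorm (y - s k) <= rnorm y * 2^-1 ^+ k.
  case: k => [|k]; first by rewrite /= subr0 expr0 mulr1.
  by have [_ /ltW] := fP (k, y - s k); rewrite /= opprD addrA.
have Fs_step k : rnorm (F (s k.+1) - F (s k)) <= M * rnorm y * 2^-1 ^+ k.
  have [Ff _] := fP (k, y - s k); rewrite /= linear_opD// addrAC subrr add0r.
  by rewrite (le_trans Ff)// -mulrA ler_wpM2l// s_near.
have [l lP] := geometric_limit Fs_step.
have -> : F y = l.
  apply: gF => e e0.
  have [k ke] := geometric_lt (rnorm y + 2 * (M * rnorm y)) e0.
  have h0 : 0 <= 2^-1 ^+ k :> K by rewrite exprn_ge0.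
  have Mh : 0 <= M * rnorm y * 2^-1 ^+ k.
    by rewrite mulr_ge0// mulr_ge0// rnorm_ge0.
  exists (s k).
    rewrite (le_lt_trans (s_near k))// (le_lt_trans _ ke)// [leRHS]mulrDl lerDl.
    by rewrite -mulrA mulr_ge0.
  rewrite (le_lt_trans (lP k))// (le_lt_trans _ ke)// [leRHS]mulrDl lerDr.
  by rewrite mulr_ge0// rnorm_ge0.
by have := lP 0%N; rewrite /= linear_op0// subr0 expr0 mulr1 mulrA.
Qed.

End closed_graph.

(** * Orthogonal projections *)

Section projection.
Context {K : realType} {H : completeNormedModType K[i]}.
Variable ip : {dot H for Num.conj}.
Hypothesis ip_norm : norm_from_inner ip.
Implicit Types (x y z : H) (N : set H).

(** A linear subspace, not necessarily closed, given as a set of vectors. *)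
Definition linear_subspace N :=
  N 0 /\ forall (a : K[i]) x y, N x -> N y -> N (a *: x + y).

(** The orthogonal complement of [N]. *)
Definition orthocomp N : set H := [set x | forall z, N z -> ip x z = 0].

(** The orthogonal projection onto [N], given by its defining property. *)
Definition projects_onto N (P : H -> H) :=
  forall x, N (P x) /\ orthocomp N (x - P x).

Lemma subspaceD N x y : linear_subspace N -> N x -> N y -> N (x + y).
Proof. by move=> [_ NP] Nx Ny; rewrite -[x]scale1r; exact: NP. Qed.

Lemma subspaceZ N a x : linear_subspace N -> N x -> N (a *: x).
Proof. by move=> [N0 NP] Nx; rewrite -[a *: x]addr0; exact: NP. Qed.

Lemma subspaceB N x y : linear_subspace N -> N x -> N y -> N (x - y).
Proof. by move=> [_ NP] Nx Ny; rewrite addrC -scaleN1r; exact: NP. Qed.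

Lemma ip_conj x y : ip x y = (ip y x)^*%R.
Proof. by rewrite hermC/= expr0 mul1r. Qed.

Lemma ip_sym_eq0 x y : ip x y = 0 -> ip y x = 0.
Proof. by move=> xy; rewrite ip_conj xy rmorph0. Qed.

Lemma ip_rnorm x : ip x x = (rnorm x ^+ 2)%:C.
Proof. by rewrite ip_norm rnormE rmorphXn. Qed.

Lemma parallelogram x y :
  rnorm (x + y) ^+ 2 + rnorm (x - y) ^+ 2 = (rnorm x ^+ 2 + rnorm y ^+ 2) *+ 2.
Proof.
suff /complexI : (rnorm (x + y) ^+ 2 + rnorm (x - y) ^+ 2)%:C =
  ((rnorm x ^+ 2 + rnorm y ^+ 2) *+ 2)%:C by [].
rewrite rmorphMn !rmorphD/= -!ip_rnorm dnormD dnormB.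
by rewrite addrACA subrr addr0 mulr2n.
Qed.

Lemma pythagoras x y : ip x y = 0 ->
  rnorm (x + y) ^+ 2 = rnorm x ^+ 2 + rnorm y ^+ 2.
Proof.
move=> xy; suff /complexI : (rnorm (x + y) ^+ 2)%:C =
  (rnorm x ^+ 2 + rnorm y ^+ 2)%:C by [].
by rewrite rmorphD/= -!ip_rnorm hnormDd.
Qed.

Lemma orthocomp_subspace N : linear_subspace (orthocomp N).
Proof.
split=> [z _|a x y Nx Ny z Nz]; first by rewrite linear0l.
by rewrite linearPl/= Nx// Ny// mulr0 addr0.
Qed.

Lemma orthocomp_self0 N x : N x -> orthocomp N x -> x = 0.
Proof.
move=> Nx /(_ _ Nx) /eqP; rewrite ip_norm sqrf_eq0 normr_eq0.
by move=> /eqP.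
Qed.

(** A minimizing sequence in [N] has geometrically decreasing steps by the
    parallelogram law, hence converges. *)
Lemma nearest_point N x : linear_subspace N -> closed N ->
  exists2 y, N y & forall z, N z -> rnorm (x - y) <= rnorm (x - z).
Proof.
move=> subN cN; pose Q := [set rnorm (x - y) ^+ 2 | y in N].
have Q_inf : has_inf Q.
  split; first by exists (rnorm (x - 0) ^+ 2); exists 0 => //; case: subN.
  by exists 0 => _ [y _ <-]; rewrite exprn_ge0// rnorm_ge0.
have Q_le z : N z -> inf Q <= rnorm (x - z) ^+ 2.
  by move=> Nz; apply: ge_inf; [case: Q_inf | exists z].
have near n : exists y, N y /\ rnorm (x - y) ^+ 2 < inf Q + (2^-1 ^+ n) ^+ 2.
  have [|_ [y Ny <-] yQ] := @inf_adherent _ Q ((2^-1 ^+ n) ^+ 2) _ Q_inf.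
    by rewrite !exprn_gt0.
  by exists y.
have [u uP] := choice near.
have u_step n : rnorm (u n.+1 - u n) <= 2 * 2^-1 ^+ n.
  rewrite -(@ler_pXn2r _ 2) ?nnegrE ?rnorm_ge0 ?mulr_ge0 ?exprn_ge0//.
  have [Nu uQ] := uP n; have [Nu' uQ'] := uP n.+1.
  have := parallelogram (x - u n) (x - u n.+1).
  have -> : x - u n - (x - u n.+1) = u n.+1 - u n.
    by rewrite opprB addrC addrA subrK.
  have -> : x - u n + (x - u n.+1) = 2%:C *: (x - 2^-1 *: (u n + u n.+1)).
    rewrite scalerBr scalerA rmorph_nat mulfV ?pnatr_eq0// scale1r.
    by rewrite addrACA -opprD scaler_nat mulr2n.
  rewrite rnormZ//.
  have Nm : N (2^-1 *: (u n + u n.+1)).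
    by apply: subspaceZ => //; exact: subspaceD.
  have := Q_le _ Nm.
  move: uQ'; rewrite [2^-1 ^+ n.+1]exprS => uQ'.
  have : 0 <= (2^-1 ^+ n) ^+ 2 :> K by rewrite sqr_ge0.
  rewrite !exprMn in uQ' *.
  set a := rnorm (x - u n) ^+ 2 in uQ *.
  set b := rnorm (x - u n.+1) ^+ 2 in uQ' *.
  set h := (2^-1 ^+ n) ^+ 2 in uQ uQ' *.
  by lra.
have [l lP] := geometric_limit u_step.
have Nl : N l.
  move/closed_approxP : cN; apply => e /(geometric_lt (2 * 2))[n ne].
  by exists (u n); [case: (uP n) | exact: le_lt_trans ne].
exists l => // z Nz; apply/ler_addgt0Pr => e /(geometric_lt 5)[n ne].
have unz : rnorm (x - u n) <= rnorm (x - z) + 2^-1 ^+ n.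
  have h0 : 0 <= 2^-1 ^+ n :> K by rewrite exprn_ge0.
  rewrite -(@ler_pXn2r _ 2) ?nnegrE ?addr_ge0 ?rnorm_ge0//.
  have [_ uQ] := uP n; rewrite (le_trans (ltW uQ))// sqrrD addrAC.
  by rewrite ler_wpDr ?lerD2r ?Q_le// mulrn_wge0// mulr_ge0// rnorm_ge0.
rewrite (le_trans (rnorm_dist (u n) _ _))//.
by have := lP n; rewrite (rnormB l); lra.
Qed.

Lemma nearest_orthogonal N x y : linear_subspace N -> N y ->
  (forall z, N z -> rnorm (x - y) <= rnorm (x - z)) -> orthocomp N (x - y).
Proof.
move=> subN Ny ymin z Nz; set w := x - y.
have [->|z0] := eqVneq z 0; first by rewrite linear0r.
have s0 : 0 < ip z z by rewrite dnorm_gt0.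
have sC : (ip z z)^*%R = ip z z by rewrite geC0_conj// ltW.
(* [t *: z] is the component of [w] along [z]; removing it decreases the square
   of the norm of [w] by [`|ip w z| ^+ 2 / ip z z]. *)
pose t := ip w z / ip z z.
have : ip w w <= ip (w - t *: z) (w - t *: z).
  rewrite !ip_rnorm lecR ler_pXn2r ?nnegrE ?rnorm_ge0//.
  rewrite /w -addrA -opprD; apply: ymin; apply: subspaceD => //.
  exact: subspaceZ.
have tz : t^*%R * ip w z = `|ip w z| ^+ 2 / ip z z.
  by rewrite rmorphM fmorphV/= sC mulrAC normCK [ip w z * _]mulrC.
have tt : `|t| ^+ 2 * ip z z = `|ip w z| ^+ 2 / ip z z.
  rewrite normf_div exprMn exprVn (gtr0_norm s0) expr2 -!mulrA; congr (_ * _).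
  by congr (_ * _); rewrite expr2 invfM -mulrA mulVf ?mulr1// gt_eqF.
have q0 : 0 <= `|ip w z| ^+ 2 / ip z z by rewrite divr_ge0 ?exprn_ge0// ltW.
have -> : ip (w - t *: z) (w - t *: z) = ip w w - `|ip w z| ^+ 2 / ip z z.
  have wtz : ip w (t *: z) = `|ip w z| ^+ 2 / ip z z by rewrite linearZr_LR.
  have /= := dnormB ip w (t *: z); rewrite wtz geC0_conj// => ->.
  have -> : ip (t *: z) (t *: z) = `|ip w z| ^+ 2 / ip z z.
    by rewrite -tt; exact: dnormZ.
  by rewrite opprD addrACA subrr addr0.
rewrite lerDl oppr_ge0 => q0'.
have /eqP : `|ip w z| ^+ 2 / ip z z == 0 by rewrite eq_le q0 q0'.
move/eqP; rewrite mulf_eq0 invr_eq0 (gt_eqF s0) orbF sqrf_eq0 normr_eq0.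
by move/eqP.
Qed.

Theorem projection_exists N : linear_subspace N -> closed N ->
  exists P, projects_onto N P.
Proof.
move=> subN cN.
have near x : exists y, N y /\ orthocomp N (x - y).
  have [y Ny ymin] := nearest_point x subN cN.
  by exists y; split=> //; exact: nearest_orthogonal.
by have [P NP] := choice near; exists P.
Qed.

Section projector.
Variables (N : set H) (P : H -> H).
Hypotheses (subN : linear_subspace N) (NP : projects_onto N P).

Lemma projection_unique x y : N y -> orthocomp N (x - y) -> P x = y.
Proof.
move=> Ny xy; have [NPx xPx] := NP x.
apply/eqP; rewrite -subr_eq0; apply/eqP; apply: (@orthocomp_self0 N).
  exact: subspaceB.
have -> : P x - y = (x - y) - (x - P x).
  by rewrite opprB [RHS]addrC addrA subrK.
exact: (subspaceB (orthocomp_subspace N)).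
Qed.

Lemma projection_id x : N x -> P x = x.
Proof.
move=> Nx; apply: projection_unique => //.
by rewrite subrr; case: (orthocomp_subspace N).
Qed.

Lemma projection_linear : linear P.
Proof.
move=> a x y; have [Nx ox] := NP x; have [Ny oy] := NP y.
have [_ NL] := subN; apply: projection_unique; first exact: NL.
rewrite opprD addrACA -scalerBr.
by have [_] := orthocomp_subspace N; apply.
Qed.

Lemma projection_rnorm x : rnorm (P x) <= rnorm x.
Proof.
have [Nx ox] := NP x.
rewrite -(@ler_pXn2r _ 2) ?nnegrE ?rnorm_ge0//.
rewrite -[in leRHS](subrK (P x) x) pythagoras; last exact: ox.
by rewrite lerDr sqr_ge0.
Qed.

Lemma projection_self_adjoint : self_adjoint ip P.
Proof.
move=> x y; have [Nx ox] := NP x; have [Ny oy] := NP y.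
have -> : ip (P x) y = ip (P x) (P y).
  by apply/eqP; rewrite -subr_eq0 -linearBr; apply/eqP/ip_sym_eq0/oy.
by apply/eqP; rewrite eq_sym -subr_eq0 -linearBl; apply/eqP/ox.
Qed.

End projector.

(** A limit of vectors orthogonal to [N] is orthogonal to [N], because
    orthogonality to [N] means having [0] as nearest point in [N]. *)
Lemma closed_orthocomp N : linear_subspace N -> closed (orthocomp N).
Proof.
move=> subN; apply/closed_approxP => x approx; rewrite -[x]subr0.
apply: nearest_orthogonal => //; first by case: subN.
move=> z Nz; rewrite subr0; apply/ler_addgt0Pr => e e0.
have [|y oy xy] := approx (e / 2); first by rewrite divr_gt0.
have yz : rnorm y <= rnorm (y - z).
  rewrite -(@ler_pXn2r _ 2) ?nnegrE ?rnorm_ge0// (pythagoras (y := - z)).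
    by rewrite lerDl sqr_ge0.
  by apply: oy; rewrite -scaleN1r; exact: subspaceZ.
have x_le := rnorm_triangle (x - y) y; rewrite subrK in x_le.
have yz_le := rnorm_dist x y z; rewrite (rnormB y x) in yz_le.
by lra.
Qed.

End projection.

(** * Moore-Penrose inverses of operators with closed range *)

Section moore_penrose.
Context {K : realType} {H : completeNormedModType K[i]}.
Variable ip : {dot H for Num.conj}.
Hypothesis ip_norm : norm_from_inner ip.
Variable C : H -> H.
Hypothesis C_bounded : bounded_operator C.

(** The kernel of the operator [C]. *)
Definition kernel : set H := [set x | C x = 0].

Lemma kernel_subspace : linear_subspace kernel.
Proof.
have lC := bounded_operator_linear C_bounded.
split=> [|a x y Cx Cy]; first exact: linear_op0.
by rewrite /kernel/= lC Cx Cy scaler0 addr0.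
Qed.

Lemma range_subspace : linear_subspace (range C).
Proof.
have lC := bounded_operator_linear C_bounded.
split=> [|a _ _ [x _ <-] [y _ <-]]; first by exists 0 => //; exact: linear_op0.
exists (a *: x + y) => //; exact: lC.
Qed.

Lemma bounded_operator_graph_closed : graph_closed C.
Proof.
move=> x y approx; have [lC [M M0 CM]] := (bounded_operatorP C).1 C_bounded.
apply/eqP; rewrite -subr_eq0; apply/eqP/rnorm_eq0/eqP.
rewrite eq_le rnorm_ge0 andbT; apply/ler_addgt0Pr => e e0; rewrite add0r.
have M1 : 0 < M + 1 by rewrite ltr_wpDl.
have [|z xz yz] := approx (e / (M + 1)); first by rewrite divr_gt0.
rewrite (le_trans (rnorm_dist (C z) _ _))// -linear_opB// (rnormB _ y).
rewrite (le_trans (lerD (CM _) (ltW yz)))//.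
rewrite (le_trans (lerD (ler_wpM2l M0 (ltW xz)) (lexx _)))//.
by rewrite -{2}[e / _]mul1r -mulrDl mulrC divfK// gt_eqF.
Qed.

Lemma closed_kernel : closed kernel.
Proof.
apply/closed_approxP => x approx; apply: bounded_operator_graph_closed => e e0.
by have [y Cy xy] := approx e e0; exists y => //; rewrite Cy subr0 rnorm0.
Qed.

(** The Moore-Penrose inverse sends [y] to the solution [x] of [C x = P y] in
    the orthogonal complement of the kernel, [P] being the orthogonal
    projection onto the range. It is bounded by the closed graph theorem. *)
Theorem moore_penrose_exists : closed (range C) ->
  exists X, moore_penrose ip C X.
Proof.
move=> cR; have lC := bounded_operator_linear C_bounded.
have subN := kernel_subspace; have subR := range_subspace.
have subO := orthocomp_subspace ip kernel.
have [P PR] := projection_exists ip_norm subR cR.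
have [Q QN] := projection_exists ip_norm subN closed_kernel.
have lP : linear P := projection_linear ip_norm subR PR.
have solve y : exists x, orthocomp ip kernel x /\ C x = P y.
  have [[x _ Cx] _] := PR y; have [NQx oQx] := QN x.
  by exists (x - Q x); split=> //; rewrite linear_opB// NQx subr0.
have [X XP] := choice solve.
have X_unique y x : orthocomp ip kernel x -> C x = P y -> X y = x.
  move=> ox Cx; have [oX CX] := XP y.
  apply/eqP; rewrite -subr_eq0; apply/eqP.
  apply: (orthocomp_self0 ip_norm (N := kernel)).
    by rewrite /kernel/= linear_opB// CX Cx subrr.
  exact: (subspaceB subO).
have lX : linear X.
  move=> a x y; have [ox Cx] := XP x; have [oy Cy] := XP y.
  by apply: X_unique; [exact: subO.2 | rewrite lC Cx Cy lP].
have gX : graph_closed X.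
  move=> y x approx; apply: X_unique.
    have /closed_approxP := closed_orthocomp ip_norm subN.
    by apply => e /approx[z _ xz]; exists (X z) => //; exact: (XP z).1.
  apply: bounded_operator_graph_closed => e /approx[z yz xz].
  exists (X z) => //; rewrite (XP z).2 -linear_opB//.
  by rewrite (le_lt_trans _ yz)//; exact: (projection_rnorm ip_norm PR).
have XC_ker u : kernel (u - X (C u)).
  rewrite /kernel/= linear_opB// (XP _).2.
  by rewrite (projection_id ip_norm subR PR) ?subrr.
exists X; split.
  by apply/bounded_operatorP; split=> //; exact: closed_graph.
have CX : C \o X = P by apply/funext => y /=; exact: (XP y).2.
split.
- by rewrite CX; exact: (projection_self_adjoint PR).
- move=> u v /=; have [ou _] := XP (C u); have [ov _] := XP (C v).
  have -> : ip (X (C u)) v = ip (X (C u)) (X (C v)).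
    by apply/eqP; rewrite -subr_eq0 -linearBr; apply/eqP/ou/XC_ker.
  apply/eqP; rewrite eq_sym -subr_eq0 -linearBl; apply/eqP/ip_sym_eq0.
  exact/ov/XC_ker.
- apply/funext => u; have := XC_ker u; rewrite /kernel/= linear_opB//.
  by move/subr0_eq.
- apply/funext => y /=; have [oy Cy] := XP y; apply: X_unique => //.
  by rewrite Cy (projection_id ip_norm subR PR (PR y).1).
Qed.

(** Among the solutions [u] of [C u = b], the vector [X b] has least norm: [X b]
    is the orthogonal projection [X (C u)] of each of them. *)
Lemma moore_penrose_pythagoras X b u : moore_penrose ip C X -> C u = b ->
  rnorm u ^+ 2 = rnorm (X b) ^+ 2 + rnorm (u - X b) ^+ 2.
Proof.
move=> [[lX _] [_ XCsa CXC _]] <-.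
have lC := bounded_operator_linear C_bounded.
rewrite -(pythagoras ip_norm) ?subrKC//.
have CXCE := congr1 (fun f => f u) CXC; rewrite /= in CXCE.
have := XCsa u (u - X (C u)); rewrite /= => ->.
by rewrite (linear_opB lC) CXCE subrr linear_op0// linear0r.
Qed.

(** [C \o X] is the identity on the range of [C]. *)
Lemma moore_penrose_solves X b : moore_penrose ip C X -> range C b ->
  C (X b) = b.
Proof. by move=> [_ [_ _ CXC _]] [u _ <-]; rewrite -[in RHS]CXC. Qed.

End moore_penrose.

(** * Minimization of a quadratic form on an affine subspace *)

Section minimization.
Context {K : realType} {H : completeNormedModType K[i]}.

(** With [B] the inverse of [R \o R], both [R \o B] and [B \o R] invert [R]. *)
Lemma sqrt_invertible (R : H -> H) :
  bounded_operator R -> invertible_op (R \o R) -> invertible_op R.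
Proof.
move=> bR [B [bB RRK KRR]]; exists (R \o B); split.
- exact: bounded_operator_comp.
- move=> x /=; have BR y : R (B y) = B (R y).
    by rewrite -[in RHS](KRR y) /= -[RHS]RRK /= !RRK.
  by rewrite BR; exact: RRK.
- by move=> x; exact: KRR.
Qed.

Lemma inv_opP (A : H -> H) : invertible_op A -> bounded_inverse A (inv_op A).
Proof. exact: xgetPex. Qed.

Lemma pinv_opP (ip : {dot H for Num.conj}) (C : H -> H) :
  (exists X, moore_penrose ip C X) -> moore_penrose ip C (pinv_op ip C).
Proof. exact: xgetPex. Qed.

End minimization.

Theorem theorem3p4 (K : realType) (H : completeNormedModType K[i])
    (ip : {dot H for Num.conj})
    (ip_norm : norm_from_inner ip)
    (H_sep : separable_space H)
    (H_inf : ~ finite_dimensional H)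
    (A : H -> H)
    (A_bounded : bounded_operator A)
    (A_singular : singular_op A)
    (A_closed : closed (range A))
    (b : H)
    (S_nonempty : [set x | A x = b] !=set0)
    (T : H -> H)
    (T_bounded : bounded_operator T)
    (T_invertible : invertible_op T)
    (T_positive : positive_op ip T)
    (T_closed : closed (range T))
    (R : H -> H)
    (R_sqrt : positive_sqrt ip T R) :
  minimizers (fun x => ip x (T x)) [set x | A x = b] =
    [set inv_op R (pinv_op ip (A \o inv_op R) b)].
Proof.
have [R_bounded [R_sa _] RRT] := R_sqrt.
have /inv_opP[S_bounded RK KR] : invertible_op R.
  by apply: sqrt_invertible => //; rewrite RRT.
set S := inv_op R in S_bounded RK KR *; pose C := A \o S.
have C_bounded : bounded_operator C by exact: bounded_operator_comp.
have C_closed : closed (range C).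
  suff -> : range C = range A by [].
  apply/seteqP; split=> [_ [x _ <-]|_ [x _ <-]]; first by exists (S x).
  by exists (R x); rewrite //= /C/= RK.
have := pinv_opP (moore_penrose_exists ip_norm C_bounded C_closed).
set X := pinv_op ip C => MP.
have CR x : C (R x) = A x by rewrite /C/= RK.
have qE x : ip x (T x) = (rnorm (R x) ^+ 2)%:C.
  by rewrite -RRT /= -R_sa; exact: ip_rnorm.
have [x0 /= Ax0] := S_nonempty.
have Axh : A (S (X b)) = b.
  by apply: (moore_penrose_solves MP); exists (R x0); rewrite // CR.
apply/seteqP; split=> [x [/= Ax xmin]|_ ->]; last first.
  split=> // y /= Ay; rewrite !qE lecR KR.
  rewrite (moore_penrose_pythagoras ip_norm C_bounded (b := b) (u := R y) MP).
    by rewrite lerDl sqr_ge0.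
  by rewrite CR.
have := xmin _ Axh; rewrite !qE lecR KR.
rewrite (moore_penrose_pythagoras ip_norm C_bounded (b := b) (u := R x) MP);
  last by rewrite CR.
rewrite gerDl => d0; apply: (can_inj RK); rewrite KR.
apply/eqP; rewrite -subr_eq0; apply/eqP/rnorm_eq0/eqP.
by rewrite -sqrf_eq0 eq_le d0 sqr_ge0.
Qed.
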